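(* Let $G$ be a graph with a hole cover $\mathcal C$ satisfying the NC property in $G$. Then every clique of $\widehat G(\mathcal C)$ is a minor of $G$; that is, if $\widehat G(\mathcal C)$ contains a clique on $n$ vertices then $G$ has a $K_n$ minor. In particular, if $G$ is $K_n$-minor-free then $\widehat G(\mathcal C)$ is $K_n$-free.
   Context: All graphs are finite and simple. A hole of $G$ is an induced cycle of length at least $4$; $\mathcal H(G)$ is the set of holes of $G$ and $\mathcal H(G,u)$ the set of holes containing $u$. A hole cover of $G$ is a nonempty $X\subseteq V(G)$ meeting every hole. A vertex $u$ satisfies the NC property in $G$ if there are no holes $H\in\mathcal H(G,u)$, $H'\in\mathcal H(G)\setminus\mathcal H(G,u)$ sharing two consecutive edges (two distinct edges with a common end vertex lying on both). A set $\mathcal C$ satisfies the NC property in $G$ if each of its vertices does and every hole contains at most one vertex of $\mathcal C$. Locally chordalizing all holes in $\mathcal H(G,u)$ by $u$ means adding all edges $uw$ with $w\ne u$ lying on some hole in $\mathcal H(G,u)$. For a hole cover $\mathcal C=\{u_1,\dots,u_k\}$ satisfying the NC property in $G$, set $G_0=G$, let $G_i$ be obtained from $G_{i-1}$ by locally chordalizing all holes in $\mathcal H(G_{i-1},u_i)$ by $u_i$, and put $\widehat G(\mathcal C)=G_k$ (this graph is chordal and independent of the ordering of $\mathcal C$). *)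

(* Defs.v *)
From mathcomp Require Import all_boot.
Set Implicit Arguments. Unset Strict Implicit. Unset Printing Implicit Defensive.

Definition graph (T : finType) := T -> T -> Prop.

Definition simple_graph (T : finType) (e : graph T) : Prop :=
  (forall x y, e x y -> e y x) /\ (forall x, ~ e x x).

(* H is a hole of e: the vertex set of an induced cycle of length >= 4.
   The cycle is given by a duplicate-free cyclic sequence c (next c x is the
   successor of x along c); "induced" = every edge between vertices of c is a
   cycle edge. *)
Definition is_hole (T : finType) (e : graph T) (H : {set T}) : Prop :=
  exists c : seq T,
    [/\ uniq c, 4 <= size c, H = [set x | x \in c],
        (forall x, x \in c -> e x (next c x)) &
        (forall x y, x \in c -> y \in c -> e x y ->
           y = next c x \/ x = next c y)].

(* NC property of a vertex u: no hole H containing u and hole H' avoiding u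
   share two consecutive edges ab, bc (a <> c); since holes are induced, an
   edge xy lies on a hole iff both ends lie on it. *)
Definition NC_vertex (T : finType) (e : graph T) (u : T) : Prop :=
  ~ exists (H H' : {set T}) (a b c : T),
      [/\ is_hole e H, is_hole e H', u \in H, u \notin H' &
      [/\ a <> c, e a b, e b c,
          [/\ a \in H, b \in H & c \in H] &
          [/\ a \in H', b \in H' & c \in H'] ] ].

Definition NC_set (T : finType) (e : graph T) (C : {set T}) : Prop :=
  (forall u, u \in C -> NC_vertex e u) /\
  (forall H, is_hole e H -> #|H :&: C| <= 1).

Definition hole_cover (T : finType) (e : graph T) (C : {set T}) : Prop :=
  C != set0 /\ (forall H, is_hole e H -> H :&: C != set0).

Definition chordalize (T : finType) (e : graph T) (u : T) : graph T :=
  fun x y =>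
    e x y
    \/ (x = u /\ y <> u /\ exists H, [/\ is_hole e H, u \in H & y \in H])
    \/ (y = u /\ x <> u /\ exists H, [/\ is_hole e H, u \in H & x \in H]).

(* \hat G(C) for C enumerated as u_1, ..., u_k (the list s) *)
Definition Ghat (T : finType) (e : graph T) (s : seq T) : graph T :=
  foldl (@chordalize T) e s.

Definition is_clique (T : finType) (e : graph T) (K : {set T}) : Prop :=
  forall x y, x \in K -> y \in K -> x <> y -> e x y.

Definition connected_in (T : finType) (e : graph T) (B : {set T}) : Prop :=
  forall x y, x \in B -> y \in B ->
    exists p : seq T,
      [/\ all (fun z => z \in B) p, last x p = y &
          forall k, k < size p -> e (nth x (x :: p) k) (nth x p k)].

Definition has_K_minor (T : finType) (e : graph T) (n : nat) : Prop :=
  exists B : 'I_n -> {set T},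
    [/\ forall i, B i != set0,
        forall i j, i != j -> [disjoint B i & B j],
        forall i, connected_in e (B i) &
        forall i j, i != j -> exists x y, [/\ x \in B i, y \in B j & e x y]].

(* Main.v *)
(** If a vertex [w] has exactly two neighbours [a], [b] in a set [X], these are
    non-adjacent, and [X] connects them, then a shortest path from [a] to [b] in
    [X] closes up to a hole through [w].  Everything rests on this.

    A hole through [u] and a non-neighbour [w] splits into two arms.  If a
    connected set [Y] avoiding [u] and not touching [w] touched both arms, it
    would give a hole through the two edges at [w] but not through [u]; so the
    NC property forbids it.  It follows that no hole of the chordalization at
    [u] contains [u]: such a hole would be a path [x], [W], [y] with [x] and [y]
    neighbours of [u] or on holes through [u], and [W] on no such hole.
    Shortest paths through [W] force the arms at [x] and at [y] to touch each
    other in all combinations, which contradicts the NC property.  Hence every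
    edge added anywhere in the construction joins some [u] in [C] to a vertex on
    a hole of the original graph through [u].

    In a clique [K] of the final graph at most one [u] carries added edges: if
    [u] and [u'] had non-neighbours [w] and [w'] in [K], either a common
    non-neighbour or the 4-cycle [u], [w'], [w], [u'] would give a hole through
    both [u] and [u'].  So [K] minus [u] is a clique of the original graph, and
    for each non-neighbour [w] of [u] in [K] one of the two arms between [u] and
    [w] avoids [K]; contracting these arms into [u] yields the minor. *)

Require Import Defs.
From mathcomp Require Import all_boot.
From mathcomp.classical Require Import boolp.

Set Implicit Arguments.
Unset Strict Implicit.
Unset Printing Implicit Defensive.

(** A boolean adjacency relation gives access to [path] and [connect]; [graph_rel] below shows that
    every graph arises this way. *)
Definition rel_graph (T : finType) (r : rel T) : graph T := fun x y => r x y.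

Section Holes.
Variables (T : finType) (r : rel T).
Hypotheses (r_sym : symmetric r) (r_irr : irreflexive r).
Notation G := (rel_graph r).

(** * Induced paths as vertex sequences *)

Fixpoint induced (s : seq T) : bool :=
  if s is x :: s' then
    [&& x \notin s', (if s' is y :: t then r x y && all (fun z => ~~ r x z) t
                      else true) & induced s']
  else true.

Lemma induced_uniq s : induced s -> uniq s.
Proof. by elim: s => //= x s IH /and3P[-> _ /IH]. Qed.

Lemma induced_path x s : induced (x :: s) -> path r x s.
Proof.
elim: s x => // y s IH x /and3P[_ /andP[rxy _] /IH ps].
by rewrite /= rxy.
Qed.

Lemma induced_head x s z : induced (x :: s) -> z \in s -> r x z -> z = head x s.
Proof.
case: s => // y s /= /and3P[_ /andP[_ /allP nr] _].
by rewrite inE => /predU1P[->//|/nr/negP].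
Qed.

Lemma induced_catr s1 s2 : induced (s1 ++ s2) -> induced s2.
Proof. by elim: s1 => //= x s1 IH /and3P[_ _ /IH]. Qed.

Lemma induced_catl s1 s2 : induced (s1 ++ s2) -> induced s1.
Proof.
elim: s1 => //= x s1 IH /and3P[xN h /IH ->]; rewrite andbT.
move: xN; rewrite mem_cat negb_or => /andP[-> _] /=.
by case: s1 h {IH} => //= y s1; rewrite all_cat => /and3P[-> ->].
Qed.

Lemma induced_cross s1 s2 x y : induced (s1 ++ s2) -> x \in s1 -> y \in s2 ->
  r x y -> x = last x s1 /\ y = head y s2.
Proof.
elim: s1 => //= a s1 IH /and3P[aN h ind].
rewrite inE => /predU1P[->|xs1] ys2 rxy; last first.
  have [e1 e2] := IH ind xs1 ys2 rxy; split=> //.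
  by rewrite e1; case: s1 xs1 {IH h ind aN e1 e2}.
case: s1 h aN ind {IH} => [|b s1] /= h aN ind; last first.
  by case/andP: h => _ /allP/(_ y); rewrite mem_cat ys2 orbT rxy => /(_ isT).
split=> //; case: s2 ys2 h aN ind => //= b s2; rewrite inE.
by case/predU1P=> // ys2 /andP[_ /allP/(_ _ ys2)]; rewrite rxy.
Qed.

Lemma induced_adj s x y : induced s -> x \in s -> y \in s -> r x y ->
  x != y -> exists s1 s2, s = s1 ++ x :: y :: s2 \/ s = s1 ++ y :: x :: s2.
Proof.
elim: s x y => // a s IH x y ind.
rewrite !inE => /predU1P[->|xs] /predU1P[->|ys] rxy xy.
- by rewrite eqxx in xy.
- have := induced_head ind ys rxy; case: s ys {IH ind} => // b s _ /= ->.
  by exists [::], s; left.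
- rewrite r_sym in rxy.
  have := induced_head ind xs rxy; case: s xs {IH ind} => // b s _ /= ->.
  by exists [::], s; right.
- have /and3P[_ _ ind'] := ind.
  by have [s1 [s2 [->|->]]] := IH _ _ ind' xs ys rxy xy; exists (a :: s1), s2;
    [left|right].
Qed.

(** Cut the path at the last vertex equal or adjacent to [a]: what remains after [a] has no chord to
    it. *)
Lemma induced_prepend a s :
  has (fun z => (a == z) || r a z) s -> induced s ->
  exists t, [/\ induced (a :: t), last a t = last a s
              & {subset a :: t <= a :: s}].
Proof.
elim: s => // x s IH /= hx /and3P[xs hs ind].
have [h|/hasPn h] := boolP (has (fun z => (a == z) || r a z) s).
  have [t [it lt st]] := IH h ind; exists t; split => //.
    by rewrite lt; case: s h {IH hx xs hs ind lt st}.
  move=> z /st; rewrite !inE => /orP[->//|->]; by rewrite !orbT.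
case: (eqVneq a x) => [->|ax].
  exists s; split => //=; first by rewrite xs hs.
  by move=> z; rewrite !inE => /orP[->|->]; rewrite ?orbT.
have rax : r a x.
  case/orP: hx => [/orP[|//]|/hasP[z /h/negP nz /nz//]].
  by rewrite (negPf ax).
exists (x :: s); split => //=.
rewrite rax xs hs ind !andbT inE (negPf ax) /=; apply/andP; split.
  by apply/negP => /h; rewrite eqxx.
by apply/allP => z /h; rewrite negb_or => /andP[].
Qed.

(** * Connection inside a vertex set *)

Definition restr (X : {set T}) : rel T :=
  fun x y => [&& x \in X, y \in X & r x y].

(** Being a reflexive closure, this relates [x] to itself even outside [X]. *)
Definition linked (X : {set T}) (x y : T) : bool := connect (restr X) x y.

Lemma linked_sym X : symmetric (linked X).
Proof.
apply: symmetric_from_pre => x y; rewrite /linked => /connectP[p pp ->].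
elim: p x pp => //= z p IH x /andP[/and3P[xX zX rxz] /IH h].
apply: connect_trans h _; apply: connect1.
by rewrite /restr xX zX r_sym.
Qed.

Lemma linked_sub (X Y : {set T}) x y :
  X \subset Y -> linked X x y -> linked Y x y.
Proof.
move=> /subsetP XY; apply: connect_sub => a b /and3P[aX bX rab].
by apply: connect1; rewrite /restr !XY.
Qed.

Lemma linked_trans X : transitive (linked X).
Proof. exact: connect_trans. Qed.

Lemma linked_edge (X : {set T}) x y : x \in X -> y \in X -> r x y -> linked X x y.
Proof. by move=> xX yX rxy; apply: connect1; rewrite /restr xX yX. Qed.

Lemma linked_in (X : {set T}) x y : x \in X -> linked X x y -> y \in X.
Proof.
move=> xX /connectP[p pp ->]; elim: p x xX pp => //= z p IH x xX.
by case/andP=> /and3P[_ zX _]; apply: IH.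
Qed.

(** A walk in [X] is absorbed from its far end, one vertex at a time, by [induced_prepend], which
    never leaves [X]. *)
Lemma linked_induced (X : {set T}) a b : a \in X -> linked X a b ->
  exists t, [/\ induced (a :: t), last a t = b & {subset a :: t <= X}].
Proof.
move=> aX /connectP[p pp ->]; elim: p a aX pp => [|x p IH] a aX /=.
  by move=> _; exists [::]; split => // z; rewrite inE => /eqP->.
case/andP=> /and3P[_ xX rax] /(IH _ xX)[t [it <- st]].
have [|t' [it' lt' st']] := @induced_prepend a (x :: t) _ it.
  by rewrite /= rax orbT.
exists t'; split => // z /st'; rewrite inE => /predU1P[->//|]; exact: st.
Qed.

Lemma induced_linked s x y : induced s -> x \in s -> y \in s ->
  linked [set z | z \in s] x y.
Proof.
case: s => // a s ind; have pas := induced_path ind.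
suff h z : z \in a :: s -> linked [set z | z \in a :: s] a z.
  move=> /h; rewrite linked_sym => h1 /h; exact: linked_trans.
elim: s a z pas {ind} => [|b s IH] a z /=.
  by move=> _; rewrite inE => /eqP->; exact: connect0.
case/andP=> rab pas; rewrite inE => /predU1P[->|/(IH _ _ pas) h].
  exact: connect0.
apply: linked_trans (_ : linked _ a b) _.
  by apply: linked_edge => //; rewrite !inE eqxx ?orbT.
apply: linked_sub h; apply/subsetP => c; rewrite !inE => ->; exact: orbT.
Qed.

(** * Holes as a vertex closing up an induced path *)

Lemma next_consecutive (c1 c2 : seq T) x y :
  uniq (c1 ++ x :: y :: c2) -> next (c1 ++ x :: y :: c2) x = y.
Proof.
move=> u; rewrite -(next_rot (size c1) u) rot_size_cat /= eqxx //.
Qed.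

Lemma next_last (x0 : T) (c : seq T) x :
  uniq (x0 :: rcons c x) -> next (x0 :: rcons c x) x = x0.
Proof.
rewrite -rcons_cons -cats1 => u.
by rewrite -(next_rot (size (x0 :: c)) u) rot_size_cat /= eqxx.
Qed.

(** The ends of the path are the only neighbours of [w] on it, so the closed cycle has no chord;
    [2 <= size t] makes its length at least four. *)
Lemma induced_hole w a t :
  w \notin a :: t -> induced (a :: t) -> 2 <= size t ->
  r w a -> r w (last a t) ->
  (forall z, z \in a :: t -> r w z -> z = a \/ z = last a t) ->
  is_hole G [set z | z \in w :: a :: t].
Proof.
move=> wN ind st rwa rwl rw.
have uc : uniq (w :: a :: t) by rewrite cons_uniq wN induced_uniq.
exists (w :: a :: t); split => //.
- move=> x xc; apply: (@next_cycle _ r) => //=.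
  by rewrite rwa rcons_path (induced_path ind) r_sym.
- have hw y : y \in a :: t -> r w y ->
    y = next (w :: a :: t) w \/ w = next (w :: a :: t) y.
    move=> yt /(rw _ yt)[->|->].
      by left; rewrite /= eqxx.
    right; move: uc; rewrite lastI => u.
    by rewrite next_last.
  move=> x y; rewrite ![_ \in w :: _]inE => /predU1P[->|xs] /predU1P[->|ys] rxy.
  + by move: rxy; rewrite /rel_graph r_irr.
  + exact: hw.
  + move: rxy; rewrite /rel_graph r_sym => /(hw _ xs)[]; by [right|left].
  + have xy : x != y by apply/eqP => e; move: rxy; rewrite /rel_graph e r_irr.
    have [s1 [s2 [E|E]]] := induced_adj ind xs ys rxy xy; [left|right];
    by move: uc; rewrite E -cat_cons => /next_consecutive->.
Qed.

Lemma hole_induced H w : is_hole (rel_graph r) H -> w \in H ->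
  exists a t, [/\ H = [set z | z \in w :: a :: t], w \notin a :: t,
     induced (a :: t), 2 <= size t &
     [/\ r w a, r w (last a t) &
     forall z, z \in a :: t -> r w z -> z = a \/ z = last a t]].
Proof.
case=> c [uc sc -> cn ci]; rewrite inE => wc.
case: (rot_to wc) => i [|a t] E.
  by move: sc; rewrite -(size_rot i) E.
have inE' z : (z \in c) = (z \in w :: a :: t) by rewrite -E mem_rot.
have nE z : next c z = next (w :: a :: t) z by rewrite -E next_rot.
have uc' : uniq (w :: a :: t) by rewrite -E rot_uniq.
have sc' : 2 <= size t by move: sc; rewrite -(size_rot i) E.
have wN : w \notin a :: t by case/andP: uc'.
have {}cn z : z \in w :: a :: t -> r z (next (w :: a :: t) z).
  by rewrite -inE' => /cn; rewrite nE.
have {}ci x y : x \in w :: a :: t -> y \in w :: a :: t -> r x y ->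
   y = next (w :: a :: t) x \/ x = next (w :: a :: t) y.
  by rewrite -!inE' -!nE; exact: ci.
exists a, t; split => //; last split.
- by apply/setP => z; rewrite !inE inE' !inE.
(* Induction over suffixes; the prefix [s1] is kept because [next] is computed on the whole
   cycle. *)
- suff h s1 s2 : a :: t = s1 ++ s2 -> induced s2 by apply: (h [::]).
  elim: s2 s1 => //= x s2 IH s1 Es.
  have -> : induced s2 by apply: (IH (rcons s1 x)); rewrite cat_rcons.
  move: (uc'); rewrite Es -cat_cons cat_uniq => /and3P[_ _ /andP[-> _]] /=.
  rewrite andbT; case: s2 Es {IH} => // y s2 Es.
  move: uc' ci cn; rewrite Es -cat_cons => uc2 ci cn.
  have nx := next_consecutive uc2.
  have xin : x \in (w :: s1) ++ [:: x, y & s2].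
    by rewrite mem_cat mem_head orbT.
  rewrite -{1}nx cn //=; apply/allP => z zs; apply/negP => rxz.
  have zin : z \in (w :: s1) ++ [:: x, y & s2].
    by rewrite mem_cat !inE zs !orbT.
  have := uc2; rewrite cat_uniq => /and3P[_ _ /and3P[xN yN us2]].
  case: (ci x z xin zin rxz) => [|xz].
    by rewrite nx => zy; rewrite -zy zs in yN.
  (* A chord from [x] to [z] makes [z] the predecessor of [x], which is [last w s1] and thus outside
     [s2]. *)
  have zE : z = last w s1.
    apply: (can_inj (prev_next uc2)); rewrite -xz.
    by move: uc2; rewrite lastI cat_rcons => /next_consecutive.
  have := uc2; rewrite cat_uniq => /and3P[_ /hasPn/(_ z) + _].
  by rewrite !inE zs !orbT => /(_ isT); rewrite /= zE -in_cons mem_last.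
- by have := cn w (mem_head _ _); rewrite /= eqxx.
- have := cn (last a t); rewrite r_sym inE mem_last orbT => /(_ isT).
  by move: uc'; rewrite lastI => /next_last->.
- move=> z zt rwz.
  have zc : z \in w :: a :: t by rewrite in_cons zt orbT.
  have [->|] := ci w z (mem_head _ _) zc rwz; first by left; rewrite /= eqxx.
  move=> wz; right; apply: (can_inj (prev_next uc')); rewrite -wz.
  by move: uc'; rewrite lastI => /next_last->.
Qed.

(** An induced path from [a] to [b] in [X] has an inner vertex, since its ends are distinct and
    non-adjacent. The last two conclusions allow the hole minus [w] to be traced inside [X]. *)
Lemma hole_through (X : {set T}) w a b :
  w \notin X -> a \in X -> b \in X -> r w a -> r w b ->
  (forall z, z \in X -> r w z -> z = a \/ z = b) ->
  a != b -> ~~ r a b -> linked X a b ->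
  exists H, [/\ is_hole G H, w \in H, a \in H, b \in H &
                H \subset w |: X /\ linked (H :\ w) a b].
Proof.
move=> wX aX bX rwa rwb rw ab nab /(linked_induced aX)[t [it lt st]].
have wt : w \notin a :: t by apply: contra wX => /st.
exists [set z | z \in w :: a :: t]; split.
- apply: induced_hole => //; last by move=> z /st; rewrite lt; exact: rw.
    case: t it lt {st wt} => [|c [|d t]] //= it lt; first by rewrite lt eqxx in ab.
    by move: it nab; rewrite lt andbT => /and3P[_ ->].
  by rewrite lt.
- by rewrite inE mem_head.
- by rewrite inE in_cons mem_head orbT.
- by rewrite inE in_cons -lt mem_last orbT.
- split.
    by apply/subsetP => z; rewrite !(inE, in_cons) -in_cons => /predU1P[->|/st->];
      rewrite ?eqxx ?orbT.
  apply: (@linked_sub [set z | z \in a :: t]).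
    apply/subsetP => z; rewrite in_setD1 !inE -in_cons => zt.
    rewrite zt orbT andbT; apply: contraNneq wt => <-; exact: zt.
  by apply: induced_linked; rewrite ?mem_head // -lt mem_last.
Qed.

(** * Touching sets, tips, and the arms of a hole *)

Definition touch (X Y : {set T}) : bool :=
  [exists x in X, exists y in Y, (x == y) || r x y].

Lemma touchP (X Y : {set T}) : reflect
  (exists x y, [/\ x \in X, y \in Y & x = y \/ r x y]) (touch X Y).
Proof.
apply: (iffP exists_inP).
  case=> x xX /exists_inP[y yY /orP[/eqP|] h]; exists x, y; split => //; by [left|right].
case=> x [y [xX yY h]]; exists x => //; apply/exists_inP; exists y => //.
by case: h => [->|->]; rewrite ?eqxx ?orbT.
Qed.

Lemma touch_sym X Y : touch X Y = touch Y X.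
Proof.
by apply/touchP/touchP => -[x [y [xX yY h]]]; exists y, x; split => //;
  case: h => [->|]; [left|rewrite r_sym; right|left|rewrite r_sym; right].
Qed.

Lemma linked_touch (A B : {set T}) a b :
  a \in A -> b \in B -> linked (A :|: B) a b -> touch A B.
Proof.
move=> aA bB /connectP[p pp E]; elim: p a aA pp E => [|x p IH] a aA /=.
  by move=> _ e; apply/touchP; exists a, b; split => //; left.
case/andP=> /and3P[_ xX rax] pp E; case: (boolP (x \in A)) => xA.
  exact: IH xA pp E.
move: xX; rewrite inE (negPf xA) /= => xB.
by apply/touchP; exists a, x; split => //; right.
Qed.

Definition conn (A : {set T}) := forall x y, x \in A -> y \in A -> linked A x y.

(** A connected set attached to [u] by a single edge: a path from [u] into [A] has to enter at
    [a]. *)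
Definition tip u (A : {set T}) a :=
  [/\ u \notin A, a \in A, r u a, (forall z, z \in A -> r u z -> z = a) & conn A].

Lemma conn1 x : conn [set x].
Proof. by move=> a b; rewrite !inE => /eqP-> /eqP->; exact: connect0. Qed.

Lemma connU (A B : {set T}) : conn A -> conn B -> touch A B -> conn (A :|: B).
Proof.
move=> cA cB /touchP[a [b [aA bB h]]].
have {}cA x y : x \in A -> y \in A -> linked (A :|: B) x y.
  by move=> xA yA; apply: linked_sub (cA x y xA yA); rewrite subsetUl.
have {}cB x y : x \in B -> y \in B -> linked (A :|: B) x y.
  by move=> xA yA; apply: linked_sub (cB x y xA yA); rewrite subsetUr.
have lab : linked (A :|: B) a b.
  case: h => [->|h]; first exact: connect0.
  by apply: linked_edge => //; rewrite inE ?aA ?bB ?orbT.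
have AB x y : x \in A -> y \in B -> linked (A :|: B) x y.
  move=> xA yB; apply: linked_trans (cB b y bB yB).
  exact: linked_trans (cA x a xA aA) lab.
move=> x y; rewrite !inE => /orP[xA|xB] /orP[yA|yB]; auto.
by rewrite linked_sym; exact: AB.
Qed.

Lemma tip1 u x : r u x -> tip u [set x] x.
Proof.
move=> rux; split; rewrite ?inE //; last exact: conn1.
- by apply: contraTneq rux => ->; rewrite r_irr.
- by move=> z; rewrite inE => /eqP.
Qed.

(** Serves to extend an arm between [u] and a non-neighbour [x] by the end [x] itself. *)
Lemma tipU1 u A a x b : tip u A a -> u != x -> ~~ r u x -> b \in A -> r x b ->
  tip u (x |: A) a.
Proof.
case=> uA aA rua un cA ux nux bA rxb; split => //.
- by rewrite !inE negb_or ux.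
- by rewrite inE aA orbT.
- move=> z; rewrite !inE => /predU1P[->|]; [by rewrite (negPf nux)|exact: un].
- apply: connU => //; first exact: conn1.
  by apply/touchP; exists x, b; rewrite inE; split => //; right.
Qed.

(** Models the two arcs of [H] left after removing [u] and [w]. *)
Definition arms (H : {set T}) u w (A B : {set T}) :=
  [/\ A \subset H, B \subset H, ~~ touch A B,
    (exists a a', tip u A a /\ tip w A a') &
    (exists b b', tip u B b /\ tip w B b')].

Lemma hole_arms H u w : is_hole G H -> u \in H -> w \in H -> u != w ->
  ~~ r u w -> exists A B, arms H u w A B.
Proof.
move=> hH uH wH uw nuw; have [a [t [HE uN ind st [rua rul run]]]] := hole_induced hH uH.
have wt : w \in a :: t by move: wH; rewrite HE !inE eq_sym (negPf uw).
(* Cut the path [H] minus [u] at [w]. An empty piece on either side would make [w] an end of the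
   path, hence a neighbour of [u]. *)
move: wt; move Es : (a :: t) => s ws; case/splitPr: ws Es => s1 s2 E.
have un := induced_uniq ind; rewrite E in un ind uN run.
case: s1 E un ind uN run => [|a1 s1] E un ind uN run.
  by case: E nuw => <- _; rewrite rua.
have lE : last a t = last w s2 by rewrite -[LHS]/(last a (a :: t)) E last_cat.
case: E => ? E; subst a1.
case: s2 E un ind uN run lE => [|b s2] E un ind uN run lE.
  by move: nuw; rewrite /= in lE; rewrite -lE rul.
rewrite /= in lE; rewrite lE in rul run.
have indA := induced_catl ind; have indB' := induced_catr ind.
have indB : induced (b :: s2) by case/and3P: indB'.
have rwa : r w (last a s1).
  by have := induced_path ind; rewrite cat_path /= r_sym => /and3P[].
have rwb : r w b by have := induced_path indB' => /andP[].
have := un; rewrite cat_uniq => /and3P[_ /hasPn dAB /andP[wB _]].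
have wA : w \notin a :: s1 by exact: dAB (mem_head _ _).
have := uN; rewrite mem_cat [_ \in w :: _]in_cons 2!negb_or => /and3P[uA _ uB].
(* By [induced_cross], an edge from the first piece across the cut ends at [w], which is not in the
   second piece. *)
have AB z z' : z \in a :: s1 -> z' \in b :: s2 -> z = z' \/ r z z' -> False.
  move=> zA zB [e|rzz].
    by have := dAB z'; rewrite in_cons zB orbT -e => /(_ isT); rewrite /= zA.
  have zB' : z' \in w :: b :: s2 by rewrite in_cons zB orbT.
  have [_ e] := induced_cross ind zA zB' rzz.
  by rewrite /= in e; rewrite -e zB in wB.
have HE' z : (z \in H) = [|| z == u, z \in a :: s1, z == w | z \in b :: s2].
  by rewrite HE inE in_cons E -cat_cons mem_cat in_cons.
exists [set z | z \in a :: s1], [set z | z \in b :: s2]; split.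
- by apply/subsetP => z; rewrite in_set HE' => ->; rewrite orbT.
- by apply/subsetP => z; rewrite in_set HE' => ->; rewrite !orbT.
- by apply/touchP => -[z [z' [+ + h]]]; rewrite !in_set => zA zB; apply: AB h.
- exists a, (last a s1); split; split; rewrite ?in_set ?mem_head ?mem_last //.
  + move=> z; rewrite in_set => zA /run[|//|zb]; first by rewrite mem_cat zA.
    by case: (AB z z zA); [rewrite zb mem_last|left].
  + by move=> x y; rewrite !in_set; apply: induced_linked.
  + move=> z; rewrite in_set => zA; rewrite r_sym => rzw.
    by have [] := induced_cross ind zA (mem_head _ _) rzw.
  + by move=> x y; rewrite !in_set; apply: induced_linked.
- exists (last b s2), b; split; split; rewrite ?in_set ?mem_head ?mem_last //.
  + move=> z; rewrite in_set => zB /run[|zb|//]; first by rewrite mem_cat [_ \in w :: _]in_cons zB !orbT.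
    by case: (AB z z _ zB); [rewrite zb mem_head|left].
  + by move=> x y; rewrite !in_set; apply: induced_linked.
  + by move=> z; rewrite in_set => zB; apply: (induced_head indB').
  + by move=> x y; rewrite !in_set; apply: induced_linked.
Qed.

(** Meant for holes of the chordalized graph: [W] collects the vertices of [H] that were not joined
    to [u]. *)
Lemma hole_neighbours H u : is_hole G H -> u \in H ->
  exists a b (W : {set T}), [/\ r u a, r u b, a != b, ~~ r a b &
   [/\ H = u |: (a |: (b |: W)), conn W,
     (exists2 c, c \in W & r a c), (exists2 d, d \in W & r b d) &
     forall z, z \in W -> z != u /\ ~~ r u z]].
Proof.
move=> hH uH; have [a [t [HE uN ind st [rua rul run]]]] := hole_induced hH uH.
case/lastP: t => [//|t b] in HE uN ind st rul run *.
rewrite last_rcons in rul run.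
case: t => [//|c t] in HE uN ind st rul run *.
have pt := induced_path ind.
have un := induced_uniq ind.
have abN : b \notin c :: t /\ a \notin rcons (c :: t) b.
  by move: un; rewrite cons_uniq rcons_uniq => /and3P[].
have it : induced (c :: t).
  by have := @induced_catr [:: a] _ ind; rewrite -cats1; apply: induced_catl.
exists a, b, [set z | z \in c :: t]; split => //.
- by case: abN => _; apply: contraNneq => ->; rewrite mem_rcons mem_head.
- apply/negP => /(induced_head ind); rewrite mem_rcons mem_head => /(_ isT) /= bc.
  by case: abN; rewrite bc mem_head.
- split.
  + apply/setP => z; rewrite HE !in_set 2!in_cons mem_rcons in_cons.
    by rewrite ![in RHS]in_set1.
  + by move=> x y; rewrite !in_set; apply: induced_linked.
  + by exists c; [rewrite in_set mem_head|case/andP: pt].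
  + exists (last c t); first by rewrite in_set mem_last.
    by move: pt; rewrite rcons_path r_sym => /andP[].
  + move=> z; rewrite in_set => zt.
    have zt' : z \in a :: rcons (c :: t) b.
      by rewrite in_cons mem_rcons in_cons zt !orbT.
    split; first by apply: contraNneq uN => <-.
    apply/negP => /(run _ zt')[] zE; case: abN; rewrite -zE ?zt //.
    by rewrite mem_rcons in_cons zt orbT.
Qed.

(** * Consequences of the NC property for arms *)

Lemma touchSl (A A' B : {set T}) : A \subset A' -> touch A B -> touch A' B.
Proof.
move=> /subsetP s /touchP[a [b [/s aA bB h]]].
by apply/touchP; exists a, b.
Qed.

Lemma touchU1 x (A B : {set T}) : touch (x |: A) B -> touch [set x] B || touch A B.
Proof.
case/touchP=> a [b [+ bB h]]; rewrite in_setU1 => /predU1P[ax|aA]; apply/orP.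
  by left; rewrite ax in h; apply/touchP; exists x, b; rewrite inE eqxx.
by right; apply/touchP; exists a, b.
Qed.

(* A connected set joining the two arms away from [w] closes up to a hole that
   keeps both edges of [H] at [w] but misses [u]. *)
Lemma NC_arms (H A B Y : {set T}) u w : NC_vertex G u -> is_hole G H -> u \in H -> w \in H ->
  u != w -> arms H u w A B -> u \notin Y -> conn Y -> ~~ touch [set w] Y ->
  touch A Y -> touch B Y -> False.
Proof.
move=> NCu hH uH wH uw [sA sB nAB [a0 [a [[uA _ _ _ cA] [wA aA rwa una _]]]]].
move=> [b0 [b [[uB _ _ _ cB] [wB bB rwb unb _]]]] uY cY nwY tA tB.
have c : conn (A :|: Y :|: B).
  apply: connU => //; first exact: connU.
  by apply: touchSl (subsetUr _ _) _; rewrite touch_sym.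
have ab : a != b.
  by apply: contra nAB => /eqP e; apply/touchP; exists a, b; split => //; left.
have nab : ~~ r a b.
  by apply: contra nAB => e; apply/touchP; exists a, b; split => //; right.
have nY y : y \in Y -> (w != y) && ~~ r w y.
  move=> yY; rewrite -negb_or; apply: contra nwY => h; apply/touchP; exists w, y.
  by rewrite inE eqxx; split => //; case/orP: h => [/eqP|]; [left|right].
have [] := @hole_through (A :|: Y :|: B) w a b => //.
- rewrite !inE (negPf wA) (negPf wB) orbF /=.
  by apply/negP => /nY; rewrite eqxx.
- by rewrite !inE aA.
- by rewrite !inE bB !orbT.
- move=> z; rewrite !inE => /orP[/orP[zA|zY]|zB] h.
  + by left; exact: una.
  + by case/andP: (nY _ zY) => _; rewrite h.
  + by right; exact: unb.
- by apply: c; rewrite !inE ?aA ?bB ?orbT.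
move=> H' [hH' wH' aH' bH' [sH' _]].
apply: NCu; exists H, H', a, w, b; split => //.
  apply/negP => /(subsetP sH'); rewrite !inE (negPf uw) /=.
  by rewrite (negPf uA) (negPf uB) (negPf uY).
split => //; first by apply/eqP.
- by rewrite /rel_graph r_sym.
- by split => //; [exact: (subsetP sA)|exact: (subsetP sB)].
Qed.

(** Otherwise the tips are distinct, non-adjacent and linked through [W], so [hole_through] yields a
    hole at [u]. It cannot use [W], so its path from [a] to [b] stays in [A :|: B] and makes the two
    sets touch after all. *)
Lemma tips_touch u (A B W : {set T}) a b x y :
  tip u A a -> tip u B b -> conn W ->
  (forall z, z \in W -> [/\ z != u, ~~ r u z
      & forall H, is_hole G H -> u \in H -> z \notin H]) ->
  x \in A -> y \in B -> touch [set x] W -> touch [set y] W -> touch A B.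
Proof.
move=> [uA aA rua una cA] [uB bB rub unb cB] cW hW xA yB tx ty.
case: (boolP (touch A B)) => // nAB.
have ab : a != b.
  by apply: contra nAB => /eqP e; apply/touchP; exists a, b; split => //; left.
have nab : ~~ r a b.
  by apply: contra nAB => e; apply/touchP; exists a, b; split => //; right.
have tA : touch A W by apply: touchSl tx; rewrite sub1set.
have tB : touch B W by apply: touchSl ty; rewrite sub1set.
have c : conn (A :|: W :|: B).
  apply: connU => //; first exact: connU.
  by apply: touchSl (subsetUr _ _) _; rewrite touch_sym.
have [] := @hole_through (A :|: W :|: B) u a b => //.
- rewrite !inE (negPf uA) (negPf uB) orbF /=.
  by apply/negP => /hW[]; rewrite eqxx.
- by rewrite !inE aA.
- by rewrite !inE bB !orbT.
- move=> z; rewrite !inE => /orP[/orP[zA|zY]|zB] h.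
  + by left; exact: una.
  + by case: (hW _ zY) => _; rewrite h.
  + by right; exact: unb.
- by apply: c; rewrite !inE ?aA ?bB ?orbT.
move=> H [hH uH aH bH [sH l]].
suff: touch A B by rewrite (negPf nAB).
apply: (linked_touch aA bB); apply: linked_sub l; apply/subsetP => z.
rewrite in_setD1 => /andP[zu zH]; move: (subsetP sH _ zH).
rewrite !inE (negPf zu) /= => /orP[/orP[->//|zW]|->]; last by rewrite orbT.
by case: (hW _ zW) => _ _ /(_ _ hH uH); rewrite zH.
Qed.

Lemma touch11 x y : touch [set x] [set y] = (x == y) || r x y.
Proof.
apply/touchP/idP.
  by case=> a [b []]; rewrite !inE => /eqP-> /eqP-> [->|->]; rewrite ?eqxx ?orbT.
move=> h; exists x, y; rewrite !inE !eqxx; split => //.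
by case/orP: h => [/eqP|]; [left|right].
Qed.

(* The path [x], [W], [y] would become a hole through [u] once [u] is joined to
   [x] and [y]. *)
Lemma NC_no_ear u x y (W : {set T}) :
  NC_vertex G u -> conn W ->
  (forall z, z \in W -> [/\ z != u, ~~ r u z
      & forall H, is_hole G H -> u \in H -> z \notin H]) ->
  touch [set x] W -> touch [set y] W -> x != y -> ~~ r x y ->
  u != x -> u != y -> ~~ r u y ->
  (r u x \/ exists H, [/\ is_hole G H, u \in H & x \in H]) ->
  (exists H, [/\ is_hole G H, u \in H & y \in H]) -> False.
Proof.
move=> NCu cW hW tx ty xy nxy ux uy nuy hx [H [hH uH yH]].
have [A [B ar]] := hole_arms hH uH yH uy nuy.
have [_ _ _ [a [a' [tuA tyA]]] [b [b' [tuB tyB]]]] := ar.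
have tuAy : tip u (y |: A) a by case: tyA => _ h1 h2 _ _; exact: tipU1 tuA _ _ h1 h2.
have tuBy : tip u (y |: B) b by case: tyB => _ h1 h2 _ _; exact: tipU1 tuB _ _ h1 h2.
(* If [x] is a neighbour of [u], this is [tips_touch] for the set of [x] alone. If not, both arms at
   [x], enlarged by [x], touch [Y]; were [x] apart from [Y], the bare arms would both touch [Y],
   against [NC_arms]. *)
have key Y c : tip u Y c -> y \in Y -> touch [set x] Y.
  move=> tuY yY; case: (boolP (r u x)) => [rux|nux].
    by apply: tips_touch (tip1 rux) tuY cW hW _ yY tx ty; rewrite inE.
  case: hx => [|[H1 [hH1 uH1 xH1]]]; first by rewrite (negPf nux).
  have [A1 [B1 ar1]] := hole_arms hH1 uH1 xH1 ux nux.
  have [_ _ _ [a1 [a1' [tuA1 txA1]]] [b1 [b1' [tuB1 txB1]]]] := ar1.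
  have tuA1x : tip u (x |: A1) a1.
    by case: txA1 => _ h1 h2 _ _; exact: tipU1 tuA1 _ _ h1 h2.
  have tuB1x : tip u (x |: B1) b1.
    by case: txB1 => _ h1 h2 _ _; exact: tipU1 tuB1 _ _ h1 h2.
  have /touchU1 tA : touch (x |: A1) Y.
    by apply: tips_touch tuA1x tuY cW hW _ yY tx ty; rewrite !inE eqxx.
  have /touchU1 tB : touch (x |: B1) Y.
    by apply: tips_touch tuB1x tuY cW hW _ yY tx ty; rewrite !inE eqxx.
  case: (boolP (touch [set x] Y)) => // nxY; rewrite (negPf nxY) /= in tA tB.
  by case: tuY => uY _ _ _ cY; case: (NC_arms NCu hH1 uH1 xH1 ux ar1 uY cY nxY).
have nyx : ~~ touch [set y] [set x].
  by rewrite touch11 r_sym eq_sym negb_or xy.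
(* Each arm at [y], enlarged by [y], touches [x], but [y] does not. So both bare arms touch [x], and
   [NC_arms] applies at [y] with joining set [[set x]]. *)
have tA : touch A [set x].
  have := key _ _ tuAy (setU11 _ _); rewrite touch_sym => /touchU1.
  by rewrite (negPf nyx).
have tB : touch B [set x].
  have := key _ _ tuBy (setU11 _ _); rewrite touch_sym => /touchU1.
  by rewrite (negPf nyx).
by apply: (NC_arms NCu hH uH yH uy ar) tA tB; rewrite ?inE //; exact: conn1.
Qed.

(** If [y] touched both arms, it would be a joining set as excluded by [NC_arms]. *)
Lemma free_arm (H : {set T}) u w y : NC_vertex G u -> is_hole G H -> u \in H ->
  w \in H -> u != w -> ~~ r u w -> u != y -> w != y -> ~~ r w y ->
  exists (B : {set T}) b b', [/\ tip u B b, tip w B b' & ~~ touch B [set y]].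
Proof.
move=> NCu hH uH wH uw nuw uy wy nwy.
have [A [B ar]] := hole_arms hH uH wH uw nuw.
have [_ _ _ [a [a' [ta ta']]] [b [b' [tb tb']]]] := ar.
case: (boolP (touch A [set y])) => [tA|ntA]; last by exists A, a, a'.
case: (boolP (touch B [set y])) => [tB|ntB]; last by exists B, b, b'.
exfalso; apply: (NC_arms NCu hH uH wH uw ar) tA tB; rewrite ?inE //.
  exact: conn1.
by rewrite touch11 negb_or wy.
Qed.

Lemma touchPn (X Y : {set T}) x y :
  ~~ touch X Y -> x \in X -> y \in Y -> x != y /\ ~~ r x y.
Proof.
move=> n xX yY; split; apply: contra n => h; apply/touchP; exists x, y; split => //.
  by left; apply/eqP.
by right.
Qed.

Lemma tip_touch u A a : tip u A a -> touch [set u] A.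
Proof.
by case=> _ aA rua _ _; apply/touchP; exists u, a; rewrite inE; split => //; right.
Qed.

(** Take an arm [B] from [u] to [w] away from [u'], and an arm [B'] from [u'] to [w] away from [u].
    Around [u'], [B'], [w], [B] the only neighbours of [u] are [u'] and the tip of [B], which gives
    a hole through [u] and [u']. *)
Lemma common_nonneighbour u u' w H H' : NC_vertex G u -> NC_vertex G u' ->
  (forall H, is_hole G H -> u \in H -> u' \in H -> False) ->
  is_hole G H -> u \in H -> w \in H -> is_hole G H' -> u' \in H' -> w \in H' ->
  u != w -> u' != w -> ~~ r u w -> ~~ r u' w -> r u u' -> False.
Proof.
move=> NCu NCu' nuu hH uH wH hH' uH' wH' uw u'w nuw nu'w ruu.
have uu : u != u' by apply: contraTneq ruu => ->; rewrite r_irr.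
have [||B [b [b' [tb tb' nt]]]] := @free_arm H u w u' NCu hH uH wH uw nuw uu.
  by rewrite eq_sym.
  by rewrite r_sym.
have [|||B' [c [c' [tc tc' nt']]]] := @free_arm H' u' w u NCu' hH' uH' wH' u'w nu'w.
  by rewrite eq_sym.
  by rewrite eq_sym.
  by rewrite r_sym.
have cX : conn ([set u'] :|: B' :|: ([set w] :|: B)).
  have [_ c'B' _ _ cB'] := tc'; have [_ _ _ _ cB] := tb'.
  apply: connU; first by apply: connU (tip_touch tc); [exact: conn1|].
    by apply: connU (tip_touch tb'); [exact: conn1|].
  apply: touchSl (subsetUr _ _) _; rewrite touch_sym.
  exact: touchSl (subsetUl _ _) (tip_touch tc').
have [uB bB rub unb _] := tb.
have [bu' nbu'] := touchPn nt bB (set11 _).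
have [] := @hole_through ([set u'] :|: B' :|: ([set w] :|: B)) u u' b => //.
- rewrite !inE (negPf uu) (negPf uw) (negPf uB) /= orbF.
  by apply/negP => /(touchPn nt')/(_ (set11 _))[]; rewrite eqxx.
- by rewrite !inE eqxx.
- by rewrite !inE bB !orbT.
- move=> z; rewrite !inE => /orP[/orP[/eqP|zB']|/predU1P[->|zB]] h; first by left.
  + by have [_] := touchPn nt' zB' (set11 _); rewrite r_sym h.
  + by rewrite h in nuw.
  + by right; exact: unb.
- by rewrite eq_sym.
- by rewrite r_sym.
- by apply: cX; rewrite !inE ?eqxx ?bB ?orbT.
by move=> H2 [hH2 uH2 uH2' _ _]; exact: (nuu H2).
Qed.

(** Both diagonals of the 4-cycle are missing, so it is a hole; it is obtained at [u] from the path
    [u'], [w], [w']. *)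
Lemma crossed_nonneighbours u u' w w' :
  (forall H, is_hole G H -> u \in H -> u' \in H -> False) ->
  r u u' -> r u w' -> r u' w -> r w w' -> ~~ r u w -> ~~ r u' w' ->
  u != w -> u' != w' -> False.
Proof.
move=> nuu ruu ruw' ru'w rww nuw nu'w' uw u'w'.
have uu : u != u' by apply: contraTneq ruu => ->; rewrite r_irr.
have uw' : u != w' by apply: contraTneq ruw' => ->; rewrite r_irr.
have [] := @hole_through [set u'; w; w'] u u' w' => //.
- by rewrite !inE !negb_or uu uw.
- by rewrite !inE eqxx.
- by rewrite !inE eqxx orbT.
- move=> z; rewrite !inE => /orP[/orP[/eqP|/eqP->]|/eqP]; [by left| |by right].
  by rewrite (negPf nuw).
- apply: linked_trans (_ : linked _ u' w) _; apply: linked_edge => //;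
  by rewrite !inE eqxx ?orbT.
by move=> H2 [hH2 uH2 uH2' _ _]; exact: (nuu H2).
Qed.

End Holes.

(** * Chordalizing at one vertex, and its iteration *)

Section Chordalize.
Variable T : finType.

Lemma graph_rel (e : graph T) : exists r, e = rel_graph r.
Proof.
exists (fun x y => `[< e x y >]); apply/funext => x; apply/funext => y.
by apply/propext; split => /asboolP.
Qed.

Lemma simple_rel (r : rel T) :
  simple_graph (rel_graph r) -> symmetric r /\ irreflexive r.
Proof.
case=> s i; split => [x y|x]; last by apply/negP => /i.
by apply/idP/idP => /s.
Qed.

Lemma is_hole_eq (e e' : graph T) (H : {set T}) :
  (forall x y, x \in H -> y \in H -> e x y <-> e' x y) ->
  is_hole e H -> is_hole e' H.
Proof.
move=> h [c [uc sc E cn ci]]; rewrite {}E in h *; exists c; split => //.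
  by move=> x xc; apply/h; rewrite ?inE ?mem_next //; exact: cn.
by move=> x y xc yc /h hxy; apply: ci => //; apply: hxy; rewrite inE.
Qed.

Lemma chordalize_simple (e : graph T) u :
  simple_graph e -> simple_graph (chordalize e u).
Proof.
case=> s i; split => [x y|x].
  by case=> [/s|[]]; [left|right; right|right; left].
by case=> [/i|[[-> [//]]|[-> [//]]]].
Qed.

Lemma chordalize_off (e : graph T) u x y :
  x != u -> y != u -> chordalize e u x y -> e x y.
Proof.
by move=> xu yu [//|[[xE]|[yE]]]; [rewrite xE eqxx in xu|rewrite yE eqxx in yu].
Qed.

Lemma chordalize_hole_notin (e : graph T) u H : simple_graph e ->
  NC_vertex e u -> is_hole (chordalize e u) H -> u \notin H.
Proof.
move=> se NCu hH; apply/negP => uH.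
have se' := chordalize_simple u se.
have [r Er] := graph_rel e; have [r' Er'] := graph_rel (chordalize e u).
have sub x y : r x y -> r' x y.
  move=> h; change (rel_graph r' x y); rewrite -Er' Er; by left.
have off x y : x != u -> y != u -> r' x y -> r x y.
  move=> xu yu h; change (rel_graph r x y); rewrite -Er.
  by apply: chordalize_off xu yu _; rewrite Er'.
have new z : z != u -> r' u z ->
    r u z \/ exists H, [/\ is_hole (rel_graph r) H, u \in H & z \in H].
  move=> zu h; have : chordalize e u u z by rewrite Er'.
  rewrite Er => -[|[[_ [_ ?]]|[]]]; [by left|by right|].
  by move=> zE; rewrite zE eqxx in zu.
have onhole z H1 : z != u -> is_hole (rel_graph r) H1 -> u \in H1 -> z \in H1 -> r' u z.
  move=> zu h1 h2 h3; change (rel_graph r' u z); rewrite -Er' Er.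
  by right; left; split => //; split; [exact/eqP|exists H1].
rewrite Er' in se' hH; rewrite Er in se NCu.
have [rs ri] := simple_rel se; have [rs' ri'] := simple_rel se'.
have [a [b [W [rua rub ab nab [HE cW ha hb hW]]]]] := hole_neighbours rs' hH uH.
have au : a != u by apply: contraTneq rua => ->; rewrite ri'.
have bu : b != u by apply: contraTneq rub => ->; rewrite ri'.
have cW' : conn r W.
  move=> x y xW yW; apply: connect_sub (cW x y xW yW) => p q /and3P[pW qW rpq].
  apply: connect1; rewrite /restr pW qW /=.
  by apply: off rpq; [case: (hW _ pW)|case: (hW _ qW)].
(* A vertex of [W] on an old hole through [u] would have been joined to [u]. *)
have hW' z : z \in W -> [/\ z != u, ~~ r u z
    & forall H, is_hole (rel_graph r) H -> u \in H -> z \notin H].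
  move=> /hW[zu nz]; split => //; first by apply: contra nz; exact: sub.
  by move=> H1 h1 h2; apply: contra nz; exact: onhole.
have tW x : x != u -> (exists2 c, c \in W & r' x c) -> touch r [set x] W.
  move=> xu [c cW1 rxc]; apply/touchP; exists x, c; rewrite inE eqxx.
  by split => //; right; apply: off => //; case: (hW _ cW1).
(* If one of the two hole edges at [u] is new, its other end serves as [y] in [NC_no_ear]. *)
case: (boolP (r u b)) => [ub|nub]; last first.
  apply: (@NC_no_ear _ r rs ri u a b W) => //; try (by rewrite eq_sym);
  try exact: tW; try exact: new.
    by apply: contra nab; exact: sub.
  by case: (new b bu rub) => //; rewrite (negPf nub).
case: (boolP (r u a)) => [ua|nua]; last first.
  apply: (@NC_no_ear _ r rs ri u b a W) => //; try (by rewrite eq_sym);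
  try exact: tW; try exact: new.
    by apply: contra nab => h; rewrite rs'; exact: sub.
  by case: (new a au rua) => //; rewrite (negPf nua).
(* Both edges at [u] are old, so [H] is an old hole through [u]; then a vertex [c] of [W] would have
   been joined to [u]. *)
have hrH : is_hole (rel_graph r) H.
  apply: is_hole_eq hH => x y xH yH; split; last exact: sub.
  have au' z : z \in H -> r' u z -> r u z.
    rewrite HE !inE => /or4P[/eqP->|/eqP->|/eqP->|zW]; rewrite ?ri' ?ua ?ub //.
    by case: (hW _ zW) => _ /negPf->.
  case: (eqVneq x u) => [->|xu]; first exact: au'.
  case: (eqVneq y u) => [->|yu]; last exact: off.
  by rewrite /rel_graph rs' rs; exact: au'.
case: ha => c cW1 _; have [cu] := hW _ cW1; apply/negP/negPn.
by apply: onhole cu hrH uH _; rewrite HE !inE cW1 !orbT.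
Qed.

(** All added edges meet [u], which the hole avoids. *)
Lemma chordalize_hole (e : graph T) u H : simple_graph e -> NC_vertex e u ->
  is_hole (chordalize e u) H -> is_hole e H.
Proof.
move=> se NCu hH; have uH := chordalize_hole_notin se NCu hH.
apply: is_hole_eq hH => x y xH yH; split; last by left.
by apply: chordalize_off; apply: contraNneq uH => <-.
Qed.

Lemma chordalize_NC (e : graph T) u v : simple_graph e -> NC_vertex e u ->
  NC_vertex e v -> NC_vertex (chordalize e u) v.
Proof.
move=> se NCu NCv [H [H' [a [b [c [hH hH' vH vH' [ac eab ebc [aH bH cH] h]]]]]]].
have uH := chordalize_hole_notin se NCu hH.
have off z : z \in H -> z != u by move=> zH; apply: contraNneq uH => <-.
apply: NCv; exists H, H', a, b, c; split => //; 
  try exact: (chordalize_hole se NCu).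
by split => //; [apply: chordalize_off eab|apply: chordalize_off ebc]; exact: off.
Qed.

(** Holes of each stage are holes of the stage before, so the hole responsible for an added edge is
    already a hole of [e]. *)
Lemma Ghat_edge (e : graph T) (C : seq T) x y : simple_graph e ->
  (forall u, u \in C -> NC_vertex e u) -> Ghat e C x y ->
  [\/ e x y, x \in C /\ (exists H, [/\ is_hole e H, x \in H & y \in H]) |
      y \in C /\ (exists H, [/\ is_hole e H, x \in H & y \in H])].
Proof.
elim: C e => [|u C IH] e se NC /=; first by move=> h; constructor 1.
have NCu := NC u (mem_head _ _).
case/IH; first exact: chordalize_simple.
- by move=> v vC; apply: chordalize_NC => //; apply: NC; rewrite inE vC orbT.
- case=> [h|[[-> [_ [H [h1 h2 h3]]]]|[-> [_ [H [h1 h2 h3]]]]]].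
  + by constructor 1.
  + by constructor 2; rewrite mem_head; split => //; exists H.
  + by constructor 3; rewrite mem_head; split => //; exists H.
- case=> xC [H [h1 h2 h3]]; constructor 2; rewrite inE xC orbT; split => //.
  by exists H; split => //; exact: (chordalize_hole se NCu).
- case=> xC [H [h1 h2 h3]]; constructor 3; rewrite inE xC orbT; split => //.
  by exists H; split => //; exact: (chordalize_hole se NCu).
Qed.

End Chordalize.

(** * From cliques of the final graph to minors *)

Section CliqueMinor.
Variables (T : finType) (r : rel T).
Hypotheses (r_sym : symmetric r) (r_irr : irreflexive r).

(* The branch set of [u] is its component in the graph without [K :\ u]; the
   other branch sets are singletons. *)
Lemma clique_but_one_minor (K : {set T}) u : u \in K ->
  (forall x y, x \in K -> y \in K -> x != y -> x != u -> y != u -> r x y) ->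
  (forall w, w \in K -> w != u -> ~~ r u w -> exists (A : {set T}) a a',
      [/\ tip r u A a, tip r w A a' & [disjoint A & K]]) ->
  has_K_minor (rel_graph r) #|K|.
Proof.
move=> uK clK arK; pose X := u |: ~: K; pose D := [set z | linked r X u z].
have uX : u \in X by rewrite !inE eqxx.
have uD : u \in D by rewrite inE; exact: connect0.
have DX z : z \in D -> z \in K -> z = u.
  rewrite inE => /(linked_in uX); rewrite !inE => /predU1P[//|/negP zK /zK//].
(* An arm avoiding [K] lies in [X] and starts next to [u], so its end at [w] belongs to [D]. *)
have Dadj w : w \in K -> w != u -> exists2 x, x \in D & r x w.
  move=> wK wu; case: (boolP (r u w)) => [ruw|nuw]; first by exists u.
  have [A [a [a' [[_ aA rua _ cA] [_ a'A rwa _ _] dA]]]] := arK w wK wu nuw.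
  have AX : A \subset X.
    apply/subsetP => z zA; rewrite !inE; apply/orP; right.
    by rewrite (disjointFr dA zA).
  exists a'; last by rewrite r_sym.
  rewrite inE; apply: linked_trans (_ : linked r X u a) _.
    by apply: linked_edge => //; exact: (subsetP AX).
  exact: linked_sub AX (cA _ _ aA a'A).
pose B (i : 'I_#|K|) := if enum_val i == u then D else [set enum_val i].
exists B; split.
- move=> i; apply/set0Pn; rewrite /B; case: eqP => _; first by exists u.
  by exists (enum_val i); rewrite inE.
- move=> i j ij; rewrite -setI_eq0; apply/eqP/setP => z; rewrite !inE.
  apply/negP => /andP[]; rewrite /B.
  have := enum_valP i; have := enum_valP j.
  have : enum_val i != enum_val j by apply: contraNneq ij => /enum_val_inj->.
  case: (eqVneq (enum_val i) u) => [->|iu]; case: (eqVneq (enum_val j) u) => [->|ju].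
  + by [].
  + move=> _ jK _ zD; rewrite inE => /eqP zj.
    by move: ju; rewrite -zj (DX z zD) ?eqxx // zj.
  + move=> _ _ iK; rewrite inE => /eqP zi zD.
    by move: iu; rewrite -zi (DX z zD) ?eqxx // zi.
  + by move=> nij _ _; rewrite !inE => /eqP-> e; rewrite e in nij.
- move=> i; rewrite /B; case: eqP => _; last first.
    by move=> x y; rewrite !inE => /eqP-> /eqP->; exists [::].
  move=> x y xD yD.
  have : linked r X x y.
    move: xD yD; rewrite !inE linked_sym //; exact: linked_trans.
  case/connectP=> p pp E; exists p; split => //.
    elim: p x xD pp {E} => //= z p IH x xD /andP[/and3P[xX zX rxz] pp].
    have zD : z \in D.
      by move: xD; rewrite !inE => /linked_trans; apply; exact: linked_edge.
    by rewrite zD; exact: IH zD pp.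
  move=> k kp; have /(pathP x)/(_ k kp)/and3P[_ _ //] := pp.
- move=> i j ij; rewrite /B.
  have := enum_valP i; have := enum_valP j.
  have : enum_val i != enum_val j by apply: contraNneq ij => /enum_val_inj->.
  case: (eqVneq (enum_val i) u) => [->|iu]; case: (eqVneq (enum_val j) u) => [->|ju].
  + by [].
  + move=> _ jK _; have [x xD rx] := Dadj _ jK ju.
    by exists x, (enum_val j); rewrite inE.
  + move=> _ _ iK; have [x xD rx] := Dadj _ iK iu.
    by exists (enum_val i), x; rewrite inE eqxx /rel_graph r_sym.
  + move=> nij jK iK; exists (enum_val i), (enum_val j); rewrite !inE !eqxx.
    by split => //; exact: clK.
Qed.

Lemma Ghat_clique_minor (C : seq T) (K : {set T}) :
  NC_set (rel_graph r) [set x | x \in C] ->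
  is_clique (Ghat (rel_graph r) C) K -> has_K_minor (rel_graph r) #|K|.
Proof.
case=> NC1 NC2 clK; pose G := rel_graph r.
have sG : simple_graph G by split => x => [y|]; rewrite /G /rel_graph ?r_irr // r_sym.
have NC u : u \in C -> NC_vertex G u by move=> uC; apply: NC1; rewrite inE.
have one u u' : u \in C -> u' \in C -> u != u' ->
    forall H, is_hole G H -> u \in H -> u' \in H -> False.
  move=> uC u'C uu H hH uH u'H; have := NC2 H hH; rewrite leqNgt => /negP; apply.
  rewrite (cardD1 u) (cardD1 u') !inE uH uC u'H u'C.
  by rewrite eq_sym uu.
have new x y : x \in K -> y \in K -> x != y -> ~~ r x y ->
    (x \in C \/ y \in C) /\ exists H, [/\ is_hole G H, x \in H & y \in H].
  move=> xK yK xy nxy; have /Ghat_edge : Ghat G C x y by apply: clK => //; exact/eqP.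
  case=> // [h|[h1 h2]|[h1 h2]]; [by rewrite /G /rel_graph h in nxy| |].
    by split => //; left.
  by split => //; right.
(* If no member of [C] in [K] has a non-neighbour in [K], then [K] is already a clique of the
   original graph. *)
case: (boolP [exists u in K, exists w in K, [&& u \in C, u != w & ~~ r u w]]); last first.
  move=> nK.
  have cl x y : x \in K -> y \in K -> x != y -> r x y.
    move=> xK yK xy; apply: contraNT nK => nxy.
    have [[xC|yC] _] := new x y xK yK xy nxy.
      by apply/exists_inP; exists x => //; apply/exists_inP; exists y; rewrite // xC xy.
    apply/exists_inP; exists y => //; apply/exists_inP; exists x => //.
    by rewrite yC eq_sym xy r_sym.
  have [->|[u uK]] := set_0Vmem K.
    by rewrite cards0; exists (fun _ => set0); split; case.
  apply: (clique_but_one_minor uK); first by move=> x y xK yK xy _ _; exact: cl.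
  by move=> w wK wu; rewrite cl // eq_sym.
case/exists_inP=> u uK /exists_inP[w wK /and3P[uC uw nuw]].
have [_ [H [hH uH wH]]] := new u w uK wK uw nuw.
(* A second pair [u'], [w'] away from [u] yields a hole through both [u] and [u']: directly if these
   are non-adjacent, by a common non-neighbour, or by the 4-cycle. *)
have key u' w' : u' \in K -> w' \in K -> u' \in C -> u' != u -> w' != u ->
    u' != w' -> ~~ r u' w' -> False.
  move=> u'K w'K u'C u'u w'u u'w' nu'w'.
  have [_ [H' [hH' u'H' w'H']]] := new u' w' u'K w'K u'w' nu'w'.
  have uu : u != u' by rewrite eq_sym.
  have nuu := one u u' uC u'C uu.
  have ruu : r u u'.
    apply/negPn/negP => /(new u u' uK u'K uu)[_ [H2 [h1 h2 h3]]].
    exact: nuu h1 h2 h3.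
  have u'w : u' != w by apply: contraNneq nuw => <-.
  have ruw' : r u w'.
    apply/negPn/negP => nuw'; have uw' : u != w' by rewrite eq_sym.
    have [_ [H2 [h1 h2 h3]]] := new u w' uK w'K uw' nuw'.
    exact: (common_nonneighbour r_sym r_irr (NC u uC) (NC u' u'C) nuu h1 h2 h3
             hH' u'H' w'H').
  have ru'w : r u' w.
    apply/negPn/negP => nu'w.
    have [_ [H2 [h1 h2 h3]]] := new u' w u'K wK u'w nu'w.
    exact: (common_nonneighbour r_sym r_irr (NC u uC) (NC u' u'C) nuu hH uH wH
             h1 h2 h3).
  have ww' : w != w' by apply: contraNneq nuw => ->.
  apply: (crossed_nonneighbours r_sym r_irr nuu ruu ruw' ru'w) => //.
  apply/negPn/negP => /(new w w' wK w'K ww')[[wC|w'C] _].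
    exact: (one u w uC wC uw H).
  exact: (one u' w' u'C w'C u'w' H').
have clKu x y : x \in K -> y \in K -> x != y -> x != u -> y != u -> r x y.
  move=> xK yK xy xu yu; apply/negPn/negP => nxy.
  have [[xC|yC] _] := new x y xK yK xy nxy; first exact: (key x y).
  by apply: (key y x); rewrite // 1?eq_sym // r_sym.
apply: (clique_but_one_minor uK clKu) => v vK vu nuv.
have uv : u != v by rewrite eq_sym.
have [_ [H2 [hH2 uH2 vH2]]] := new u v uK vK uv nuv.
have [A [B [_ _ nAB [a [a' [ta ta']]] [b [b' [tb tb']]]]]] :=
  hole_arms r_sym hH2 uH2 vH2 uv nuv.
case: (boolP [disjoint A & K]) => [dA|]; first by exists A, a, a'.
case: (boolP [disjoint B & K]) => [dB _|]; first by exists B, b, b'.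
move=> /pred0Pn[t /andP[/= tB tK]] /pred0Pn[s /andP[/= sA sK]].
have [st /negP[]] := touchPn nAB sA tB; apply: clKu => //.
  by case: ta => uA _ _ _ _; apply: contraNneq uA => <-.
by case: tb => uB _ _ _ _; apply: contraNneq uB => <-.
Qed.

End CliqueMinor.

Theorem theorem2p8 (T : finType) (e : graph T) (C : seq T) :
  simple_graph e -> uniq C ->
  hole_cover e [set x | x \in C] -> NC_set e [set x | x \in C] ->
  (forall K : {set T}, is_clique (Ghat e C) K -> has_K_minor e #|K|) /\
  (forall n : nat, ~ has_K_minor e n ->
     ~ exists K : {set T}, is_clique (Ghat e C) K /\ #|K| = n).
Proof.
have [r ->] := graph_rel e => /simple_rel[rs ri] _ _ NC.
have minor K := Ghat_clique_minor rs ri (K := K) NC.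
by split=> // n nK [K [/minor h hn]]; apply: nK; rewrite -hn.
Qed.
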